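(* Let $r,d,m,n$ be positive integers with $m<b(r,d)$, and suppose $n\ge b(r,d)-m+1$. Let $X_{r,d^m,n}\subseteq(\mathbb{P}^r)^n$ be the set of point configurations $(p_1,\ldots,p_n)$ such that $p_1,\ldots,p_n$ lie on the intersection of $m$ linearly independent degree $d$ hypersurfaces in $\mathbb{P}^r$. Then $X_{r,d^m,n}$ is the Zariski closed subset of $(\mathbb{P}^r)^n$ defined by the vanishing of the minors of size $b(r,d)-m+1$ of the multi-Veronese matrix $\mathbf{M}_{r,d,n}(\mathbf{x})$.
   Context: The base field $\Bbbk$ is arbitrary; $b(r,d)=\dim\mathrm{H}^0(\mathbb{P}^r,\mathcal{O}(d))=\binom{r+d}{d}$. For $\mathbf{x}=(x_1,\ldots,x_n)\in(\mathbb{P}^r)^n$, $\mathbf{M}_{r,d,n}(\mathbf{x})$ is the $b(r,d)\times n$ matrix $(v(x_1),\ldots,v(x_n))$, where $v\colon\mathbb{P}^r\hookrightarrow\mathbb{P}^{b(r,d)-1}$ is the degree $d$ Veronese embedding, i.e. the $i$-th column is the vector of all degree $d$ monomials in the homogeneous coordinates of $x_i$. *)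

(* Defs.v *)
From HB Require Import structures.
From mathcomp Require Import all_boot all_order all_algebra.
From mathcomp.multinomials Require Export mpoly.

Set Implicit Arguments.
Unset Strict Implicit.
Unset Printing Implicit Defensive.

Import GRing.Theory.
Local Open Scope ring_scope.

(* The dimension of H^0(P^r, O(d)) *)
Definition b (r d : nat) : nat := 'C(r + d, d).

(* The k-rational points of P^r: the lines through the origin of k^(r+1). *)
Definition proj_space (k : fieldType) (r : nat) : Type :=
  {U : {vspace 'rV[k]_r.+1} | \dim U == 1%N}.

(* u is a vector of homogeneous coordinates of p; as p has dimension 1, this
   forces u != 0, and u is unique up to a nonzero scalar. *)
Definition homog_coords (k : fieldType) (r : nat)
    (u : 'rV[k]_r.+1) (p : proj_space k r) : Prop :=
  <[u]>%VS = val p.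

(* Row j of A is a vector of homogeneous coordinates of the j-th point. *)
Definition config_coords (k : fieldType) (r n : nat)
    (A : 'M[k]_(n, r.+1)) (x : 'I_n -> proj_space k r) : Prop :=
  forall j, homog_coords (row j A) (x j).

(* [basis r.+1 d] is the set of nondecreasing d-tuples of indices, and [s2m]
   sends such a tuple to the corresponding product of variables. *)
Definition monomials (r d : nat) : seq 'X_{1..r.+1} :=
  [seq s2m t | t : d.-tuple 'I_r.+1 <- enum (basis r.+1 d)].

Lemma size_monomials r d : size (monomials r d) = b r d.
Proof. by rewrite size_basis addnC. Qed.

Lemma uniq_monomials r d : uniq (monomials r d).
Proof. exact: uniq_basis. Qed.

Lemma mem_monomials r d (a : 'X_{1..r.+1}) :
  (a \in monomials r d) = (mdeg a == d).
Proof. by rewrite basis_cover. Qed.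

Definition monomial (r d : nat) (i : 'I_(b r d)) : 'X_{1..r.+1} :=
  nth 0%MM (monomials r d) i.

(* The degree d Veronese map on homogeneous coordinates. *)
Definition veronese (R : comNzRingType) (r d : nat) (u : 'rV[R]_r.+1) :
    'cV[R]_(b r d) :=
  \col_i \prod_(l < r.+1) u 0 l ^+ monomial i l.

(* M_{r,d,n}: column j is the Veronese vector of row j of A. *)
Definition multi_veronese (R : comNzRingType) (r d n : nat)
    (A : 'M[R]_(n, r.+1)) : 'M[R]_(b r d, n) :=
  \matrix_(i, j) veronese d (row j A) i 0.

(* The (r+1)n variables are indexed by pairs (j, l): 'X_(mxvec_index j l) is the
   l-th homogeneous coordinate of the j-th point. *)
Definition generic_config (k : fieldType) (r n : nat) :
    'M[{mpoly k[n * r.+1]}]_(n, r.+1) :=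
  \matrix_(j, l) 'X_(mxvec_index j l).

Definition eval_config (k : fieldType) (r n : nat)
    (A : 'M[k]_(n, r.+1)) (f : {mpoly k[n * r.+1]}) : k :=
  f.@[fun i => mxvec A 0 i].

Lemma eval_multi_veronese (k : fieldType) (r d n : nat) (A : 'M[k]_(n, r.+1)) :
  map_mx (eval_config A) (multi_veronese d (generic_config k r n)) =
  multi_veronese d A.
Proof.
apply/matrixP=> i j; rewrite !mxE /eval_config rmorph_prod /=.
by apply: eq_bigr => l _; rewrite rmorphXn /= !mxE mevalXU mxvecE.
Qed.

(* f is homogeneous, of some degree e j, in the coordinates of the j-th point,
   for every j. *)
Definition multihomogeneous (k : fieldType) (r n : nat)
    (f : {mpoly k[n * r.+1]}) : Prop :=
  exists e : 'I_n -> nat, forall a, a \in msupp f ->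
    forall j, (\sum_(l < r.+1) a (mxvec_index j l))%N = e j.

Definition zero_locus (k : fieldType) (r n : nat)
    (S : {mpoly k[n * r.+1]} -> Prop) (x : 'I_n -> proj_space k r) : Prop :=
  forall f, S f -> forall A, config_coords A x -> eval_config A f = 0.

Definition zariski_closed (k : fieldType) (r n : nat)
    (Z : ('I_n -> proj_space k r) -> Prop) : Prop :=
  exists S : {mpoly k[n * r.+1]} -> Prop,
    (forall f, S f -> multihomogeneous f) /\
    (forall x, Z x <-> zero_locus S x).

Definition is_minor (R : comNzRingType) (p q s : nat) (M : 'M[R]_(p, q))
    (f : R) : Prop :=
  exists (rows : 'I_s -> 'I_p) (cols : 'I_s -> 'I_q),
    [/\ {homo rows : i j / (i < j)%N}, {homo cols : i j / (i < j)%N} &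
        f = \det (mxsub rows cols M)].

Definition on_hypersurface (k : fieldType) (r d : nat)
    (F : dhomog r.+1 k d) (p : proj_space k r) : Prop :=
  forall u, homog_coords u p -> (F : {mpoly k[r.+1]}).@[fun l => u 0 l] = 0.

(* X_{r,d^m,n}; linear independence of hypersurfaces is that of the degree d
   forms defining them. *)
Definition X_locus (k : fieldType) (r d m n : nat)
    (x : 'I_n -> proj_space k r) : Prop :=
  exists F : m.-tuple (dhomog r.+1 k d),
    free F /\ forall i j, on_hypersurface (tnth F i) (x j).

(* Main.v *)
Require Import Defs.
From mathcomp Require Import all_boot all_order all_algebra.
From mathcomp Require Import perm.

Set Implicit Arguments.
Unset Strict Implicit.
Unset Printing Implicit Defensive.

(** A degree d form F is the same thing as its row of coefficients c in
    k^(b r d), and its value at u is the product of c with the Veronese vector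
    of u ([meval_form]).  Hence F vanishes at all the points of a configuration
    exactly when c lies in the left kernel of the Veronese matrix M evaluated at
    homogeneous coordinates of the points, whichever coordinates are chosen,
    since rescaling u by a multiplies its Veronese vector by a ^ d.  As free
    families of forms correspond to free families of rows, m independent
    hypersurfaces pass through the points exactly when the left kernel has
    dimension at least m, that is when M has rank at most b r d - m
    ([X_locus_rank]).

    Over a field, having rank less than s means that all minors of size s
    vanish ([rank_lt_minors]).  Minors are indexed by increasing selections of
    rows and columns, so the work there is to extract from M an invertible
    submatrix of size s whose indices are increasing.

    Evaluation of polynomials commutes with determinants, so that the minors of
    M are the values of those of the generic Veronese matrix.  These are
    multihomogeneous because all the entries of column j are monomials of
    degree d in the coordinates of the point j, so that every term of the
    Leibniz expansion has the same multidegree ([minor_multihomogeneous]).  The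
    minors therefore are a legitimate system of equations, which makes the locus
    Zariski closed. *)

Import GRing.Theory.
Local Open Scope ring_scope.

(** * Rank and minors with increasing indices *)

Lemma enum_val_homo (p : nat) (S : {set 'I_p}) :
  {homo (@enum_val _ (mem S)) : i j / (i < j)%N}.
Proof.
move=> i j lt_ij; (* A default value for nth, never reached. *)
have x0 := enum_val i.
have srt : sorted ltn (map val (enum S)).
  rewrite (@subseq_sorted _ ltn ltn_trans _ (iota 0 p)) ?iota_ltn_sorted //.
  by rewrite -val_enum_ord map_subseq // enumT filter_subseq.
have := sorted_ltn_nth ltn_trans (val x0) srt.
move=> /(_ i j); rewrite !inE !size_map -cardE !ltn_ord => /(_ isT isT lt_ij).
by rewrite !(nth_map x0) -?cardE ?ltn_ord // -!enum_val_nth.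
Qed.

(** An injective selection of rows can be made increasing by enumerating its
    image in order: this only permutes the selected rows. *)
Lemma eqmx_rowsub_homo (F : fieldType) (s p q : nat) (A : 'M[F]_(p, q))
    (f : 'I_s -> 'I_p) :
  injective f ->
  exists2 g : 'I_s -> 'I_p,
    {homo g : i j / (i < j)%N} & (rowsub g A :=: rowsub f A)%MS.
Proof.
move=> f_inj; pose S := [set f i | i in 'I_s].
have cardS : #|S| = s by rewrite card_imset // card_ord.
have fS i : f i \in S by apply: imset_f.
exists (fun i => enum_val (cast_ord (esym cardS) i)) => [i j lt_ij|].
  exact: enum_val_homo.
(* h i is the rank of f i in the image of f, so that f factors as g \o h. *)
pose h i := cast_ord cardS (enum_rank_in (fS i) (f i)).
have fE i : f i = enum_val (cast_ord (esym cardS) (h i)).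
  by rewrite cast_ordK enum_rankK_in.
apply/eqmx_sym/(eqmx_rowsub h) => // i j eq_h.
by apply: f_inj; rewrite !fE eq_h.
Qed.

(** The s first indices of a maximal free selection of rows still select free
    rows, and they can then be put in increasing order. *)
Lemma free_rowsub_homo (F : fieldType) (s p q : nat) (A : 'M[F]_(p, q)) :
  (s <= \rank A)%N ->
  exists2 g : 'I_s -> 'I_p,
    {homo g : i j / (i < j)%N} & \rank (rowsub g A) = s.
Proof.
move=> le_s; pose f := maxrankfun A \o widen_ord le_s.
have f_inj : injective f.
  by move=> i j /maxrankfun_inj /(congr1 val) /= /val_inj.
have [g g_homo eq_g] := eqmx_rowsub_homo A f_inj.
exists g => //; rewrite eq_g; apply/eqP.
rewrite rowsub_comp rowsubE mxrankMfree.
  have -> : rowsub (widen_ord le_s) 1%:M = pid_mx s :> 'M[F]_(s, \rank A).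
    by apply/matrixP=> i j; rewrite !mxE -!val_eqE /= ltn_ord andbT.
  by rewrite rank_pid_mx.
exact: maxrowsub_free.
Qed.

(** A nonzero minor of size s is an invertible submatrix, which bounds the rank
    from below.  Conversely, if the rank is at least s, one selects s free rows,
    and then s free columns of the resulting matrix of rank s. *)
Lemma rank_lt_minors (F : fieldType) (p q s : nat) (M : 'M[F]_(p, q)) :
  (\rank M < s)%N <-> forall f, is_minor s M f -> f = 0.
Proof.
split=> [lt_s f [rows [cols [_ _ ->]]]|minor0].
  apply/eqP; apply: contraLR lt_s; rewrite -unitfE -unitmxE => Usub.
  rewrite -leqNgt -{1}(mxrank_unit Usub) mxsubrc.
  apply: leq_trans (mxrankS (rowsub_sub _ _)) _.
  by rewrite -mxrank_tr trmx_mxsub -[leqRHS]mxrank_tr mxrankS ?rowsub_sub.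
rewrite ltnNge; apply/negP => le_s.
have [rows rows_homo rk_rows] := free_rowsub_homo le_s.
have := leqnn s; rewrite -{2}rk_rows -mxrank_tr.
case/free_rowsub_homo => cols cols_homo rk_cols.
have /eqP : \det (mxsub rows cols M) = 0 by apply: minor0; exists rows, cols.
apply/negP; rewrite -unitfE -unitmxE -row_full_unit /row_full.
by rewrite mxsubcr -mxrank_tr trmx_mxsub rk_cols.
Qed.

(** * Minors of the generic Veronese matrix *)

Lemma eval_minor (k : fieldType) (r n d s : nat) (A : 'M[k]_(n, r.+1)) f :
  is_minor s (multi_veronese d (generic_config k r n)) f ->
  is_minor s (multi_veronese d A) (eval_config A f).
Proof.
case=> rows [cols [rows_homo cols_homo ->]]; exists rows, cols; split=> //.
rewrite -eval_multi_veronese -map_mxsub.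
exact/esym/(det_map_mx (meval (fun i => mxvec A 0 i))).
Qed.

Lemma minor_eval (k : fieldType) (r n d s : nat) (A : 'M[k]_(n, r.+1)) c :
  is_minor s (multi_veronese d A) c ->
  exists2 f, is_minor s (multi_veronese d (generic_config k r n)) f
           & c = eval_config A f.
Proof.
case=> rows [cols [rows_homo cols_homo ->]].
exists (\det (mxsub rows cols (multi_veronese d (generic_config k r n)))).
  by exists rows, cols.
rewrite -eval_multi_veronese -map_mxsub.
exact/(det_map_mx (meval (fun i => mxvec A 0 i))).
Qed.

Lemma mdeg_monomial (r d : nat) (i : 'I_(b r d)) : mdeg (monomial i) = d.
Proof. by apply/eqP; rewrite -mem_monomials mem_nth // size_monomials. Qed.

Lemma monomial_inj (r d : nat) : injective (@monomial r d).
Proof.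
move=> i j /eqP; rewrite nth_uniq ?size_monomials ?uniq_monomials //.
by move/eqP/val_inj.
Qed.

Lemma monomialP (r d : nat) (a : 'X_{1..r.+1}) :
  mdeg a = d -> exists i : 'I_(b r d), monomial i = a.
Proof.
move/eqP; rewrite -mem_monomials => /(nthP 0%MM)[i].
by rewrite size_monomials => lt_i <-; exists (Ordinal lt_i).
Qed.

Section Multidegree.
Variables (k : fieldType) (r n : nat).

(** Compared with [multihomogeneous], the multidegree is made explicit:
    sums stay multihomogeneous only if all the terms share it. *)
Definition multidegree (e : 'I_n -> nat) (f : {mpoly k[n * r.+1]}) : Prop :=
  forall a, a \in msupp f ->
    forall j, (\sum_(l < r.+1) a (mxvec_index j l))%N = e j.

Lemma multidegree1 : multidegree (fun=> 0%N) 1.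
Proof.
move=> a; rewrite msupp1 inE => /eqP-> j.
by rewrite big1 // => l _; rewrite mnm0E.
Qed.

Lemma multidegreeM e1 e2 f1 f2 :
  multidegree e1 f1 -> multidegree e2 f2 ->
  multidegree (fun j => e1 j + e2 j)%N (f1 * f2).
Proof.
move=> h1 h2 a /msuppM_le /allpairsP[[a1 a2] /= [in1 in2 ->]] j.
rewrite -(h1 _ in1) -(h2 _ in2) -big_split.
by apply: eq_bigr => l _; rewrite mnmDE.
Qed.

Lemma multidegree_prod (I : Type) (s : seq I) (e : I -> 'I_n -> nat) f :
  (forall i, multidegree (e i) (f i)) ->
  multidegree (fun j => \sum_(i <- s) e i j)%N (\prod_(i <- s) f i).
Proof.
move=> h; elim: s => [|i s IHs].
  by rewrite big_nil => a /multidegree1 ha j; rewrite big_nil.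
by rewrite big_cons => a /(multidegreeM (h i) IHs) ha j; rewrite big_cons.
Qed.

Lemma multidegree_sum (I : Type) (s : seq I) e f :
  (forall i, multidegree e (f i)) -> multidegree e (\sum_(i <- s) f i).
Proof.
move=> h; elim: s => [|i s IHs]; first by rewrite big_nil => a; rewrite msupp0.
rewrite big_cons => a /msuppD_le; rewrite mem_cat => /orP[/h|/IHs]; exact.
Qed.

Lemma eq_mxvec_index (j j' : 'I_n) (l l' : 'I_r.+1) :
  (mxvec_index j l == mxvec_index j' l') = (j == j') && (l == l').
Proof.
by rewrite (inj_eq (can_inj (@cast_ordK _ _ _))) (inj_eq enum_rank_inj).
Qed.

Lemma multidegreeXn (j0 : 'I_n) (l : 'I_r.+1) c :
  multidegree (fun j => c * (j0 == j))%N ('X_(mxvec_index j0 l) ^+ c).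
Proof.
rewrite mpolyXn => a; rewrite msuppX inE => /eqP-> j.
rewrite (bigD1 l) //= big1 => [|l' ne_l'].
  by rewrite addn0 mulmnE mnm1E eq_mxvec_index eqxx andbT mulnC.
by rewrite mulmnE mnm1E eq_mxvec_index (eq_sym l) (negPf ne_l') andbF.
Qed.

Lemma multidegree_veronese (d : nat) i j0 :
  multidegree (fun j => d * (j0 == j))%N
    (multi_veronese d (generic_config k r n) i j0).
Proof.
rewrite !mxE => a; under eq_bigr do rewrite !mxE.
move=> /(multidegree_prod (fun l => @multidegreeXn j0 l (monomial i l))) aE j.
by rewrite aE -big_distrl /= -mdegE mdeg_monomial.
Qed.

Lemma multidegree_sign e (c : bool) f :
  multidegree e f -> multidegree e ((-1) ^+ c * f).
Proof.
case: c; rewrite ?mul1r // mulN1r => h a.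
by rewrite (perm_mem (msuppN _)); apply: h.
Qed.

(** In the term of the Leibniz expansion given by a permutation sg, row i
    contributes an entry of column cols (sg i), of degree d in the point with
    that index.  Summing over i, the permutation disappears by reindexing. *)
Lemma minor_multihomogeneous (d s : nat) f :
  is_minor s (multi_veronese d (generic_config k r n)) f -> multihomogeneous f.
Proof.
case=> rows [cols [_ _ ->]].
exists (fun j => \sum_(i < s) d * (cols i == j))%N.
apply: multidegree_sum => sg; apply: multidegree_sign => a.
under eq_bigr do rewrite mxE.
move=> /(multidegree_prod
  (fun i => @multidegree_veronese d (rows i) (cols (sg i)))) aE j.
by rewrite aE [RHS](reindex_inj (@perm_inj _ sg)).
Qed.

End Multidegree.

(** * Degree d forms as linear forms on the Veronese vectors *)

Section Forms.
Variables (k : fieldType) (r d : nat).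

Definition coefs (F : {mpoly k[r.+1]}) : 'rV[k]_(b r d) :=
  \row_i F@_(monomial i).

Definition form (c : 'rV[k]_(b r d)) : {mpoly k[r.+1]} :=
  \sum_i c 0 i *: 'X_[monomial i].

Lemma form_dhomog c : form c \is d.-homog.
Proof.
apply: rpred_sum => i _; apply: rpredZ.
by rewrite dhomogX /= mdeg_monomial.
Qed.

Lemma formK : cancel form coefs.
Proof.
move=> c; apply/rowP=> i; rewrite mxE raddf_sum (bigD1 i) //=.
rewrite mcoeffZ mcoeffX eqxx mulr1 big1 ?addr0 // => j ne_ji.
by rewrite mcoeffZ mcoeffX (inj_eq (@monomial_inj r d)) (negPf ne_ji) mulr0.
Qed.

Lemma coefsK F : F \is d.-homog -> form (coefs F) = F.
Proof.
move=> homF; apply/mpolyP=> a.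
have [/monomialP[i <-]|ne_a] := eqVneq (mdeg a) d.
  by have /rowP/(_ i) := formK (coefs F); rewrite !mxE.
by rewrite !(dhomog_nemf_coeff _ ne_a) ?form_dhomog.
Qed.

Lemma meval_form c (u : 'rV[k]_r.+1) :
  (form c).@[fun l => u 0 l] = (c *m veronese d u) 0 0.
Proof.
rewrite raddf_sum mxE; apply: eq_bigr => i _ /=.
by rewrite mevalZ mevalX mxE.
Qed.

Lemma veroneseZ c (u : 'rV[k]_r.+1) :
  veronese d (c *: u) = c ^+ d *: veronese d u.
Proof.
apply/colP=> i; rewrite !mxE.
under eq_bigr do rewrite mxE exprMn.
rewrite big_split /= prodrXr; congr (_ ^+ _ * _).
by rewrite -mdegE mdeg_monomial.
Qed.

Lemma homog_coords_scale (u v : 'rV[k]_r.+1) p :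
  homog_coords u p -> homog_coords v p -> exists c, v = c *: u.
Proof.
rewrite /homog_coords => up vp; apply/vlineP.
by rewrite up -vp memv_line.
Qed.

(** One vector of homogeneous coordinates suffices to test the vanishing of F at
    p: any other one is a multiple, and [veroneseZ] applies. *)
Lemma on_hypersurfaceE (F : dhomog r.+1 k d) u p :
  homog_coords u p ->
  on_hypersurface F p <-> coefs F *m veronese d u = 0.
Proof.
have mevalF (v : 'rV_r.+1) :
    (F : {mpoly k[r.+1]}).@[fun l => v 0 l] = (coefs F *m veronese d v) 0 0.
  by rewrite -meval_form (coefsK (dhomog_is_dhomog F)).
move=> up; split=> [/(_ u up)|Fu v /(homog_coords_scale up)[c ->]].
  by rewrite mevalF => Fu; apply/matrixP=> i j; rewrite !ord1 Fu mxE.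
by rewrite mevalF veroneseZ -scalemxAr Fu scaler0 mxE.
Qed.

Lemma coefs_eq0 (F : dhomog r.+1 k d) : coefs F = 0 -> F = 0.
Proof.
move=> F0; apply: val_inj; rewrite /= -[LHS](coefsK (dhomog_is_dhomog F)) F0.
by rewrite /form big1 // => i _; rewrite mxE scale0r.
Qed.

(** By [coefs_eq0], taking coefficients is a linear injection, so it preserves
    and reflects linear independence. *)
Lemma free_coefs m (F : m.-tuple (dhomog r.+1 k d)) :
  free F = row_free (\matrix_i coefs (tnth F i)).
Proof.
have coefs_sum (v : 'rV_m) :
    coefs (\sum_i v 0 i *: tnth F i : dhomog _ _ _) =
    v *m (\matrix_i coefs (tnth F i)).
  apply/rowP=> j; rewrite !mxE !raddf_sum; apply: eq_bigr => i _ /=.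
  by rewrite !mxE linearZ.
apply/freeP/idP => [freeF|/row_freeP[B FB] c Fc i].
  apply: inj_row_free => v; rewrite -coefs_sum => v0.
  apply/rowP=> i; rewrite [RHS]mxE; apply: (freeF (fun i => v 0 i)).
  under eq_bigr do rewrite -tnth_nth.
  exact: coefs_eq0.
have := coefs_sum (\row_i c i).
under eq_bigr do rewrite mxE (tnth_nth 0).
rewrite Fc => /(congr1 (mulmx^~ B)).
rewrite -mulmxA FB mulmx1 => /rowP/(_ i); rewrite !mxE => <-.
by rewrite big1 // => j _; rewrite mxE mcoeff0 mul0r.
Qed.

Lemma config_coords_exists n (x : 'I_n -> proj_space k r) :
  exists A, config_coords A x.
Proof.
exists (\matrix_j vpick (val (x j))) => j; rewrite /homog_coords rowK.
apply/eqP; rewrite eqEdim -memvE memv_pick /= dim_vline (eqP (valP (x j))).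
by rewrite vpick0 -dimv_eq0 (eqP (valP (x j))).
Qed.

(** The rows of coefficients of m forms through the points are m free rows in
    the left kernel of the Veronese matrix, whose dimension is the corank. *)
Lemma X_locus_rank m n (x : 'I_n -> proj_space k r) A :
  config_coords A x -> (m <= b r d)%N ->
  X_locus d m x <-> (\rank (multi_veronese d A) <= b r d - m)%N.
Proof.
move=> Ax le_m; set M := multi_veronese d A.
have mulM (C : 'M_(m, b r d)) :
    C *m M = 0 <-> forall i j, row i C *m veronese d (row j A) = 0.
  have entryM i j : (C *m M) i j = (row i C *m veronese d (row j A)) 0 0.
    by rewrite !mxE; apply: eq_bigr => l _; rewrite !mxE.
  split=> [CM i j|CM]; last by apply/matrixP=> i j; rewrite entryM CM !mxE.
  by apply/matrixP=> i0 j0; rewrite !ord1 -entryM CM !mxE.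
have -> : (\rank M <= b r d - m)%N = (m <= \rank (kermx M))%N.
  by rewrite mxrank_ker leq_subCr // rank_leq_row.
split=> [[F [freeF onF]]|le_ker].
  rewrite free_coefs in freeF; rewrite -(eqP freeF).
  apply/mxrankS/sub_kermxP/mulM => i j; rewrite rowK.
  exact/(on_hypersurfaceE _ (Ax j))/onF.
have [g _ rk_g] := free_rowsub_homo le_ker.
pose C := rowsub g (kermx M).
exists [tuple DHomog (form_dhomog (row i C)) | i < m]; split.
  rewrite free_coefs (_ : (\matrix_i _) = C); first exact/eqP.
  by apply/row_matrixP=> i; rewrite rowK tnth_mktuple /= formK.
move=> i j; apply/(on_hypersurfaceE _ (Ax j)); rewrite tnth_mktuple /= formK.
by move: i j; apply/mulM/sub_kermxP/rowsub_sub.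
Qed.

End Forms.

Local Close Scope ring_scope.

Theorem proposition2p4 (k : fieldType) (r d m n : nat)
    (r_gt0 : 0 < r) (d_gt0 : 0 < d) (m_gt0 : 0 < m) (n_gt0 : 0 < n)
    (m_lt_b : m < b r d) (n_ge : b r d - m + 1 <= n) :
  let minors := is_minor (b r d - m + 1)
                  (multi_veronese d (generic_config k r n)) in
  [/\ zariski_closed (@X_locus k r d m n),
      forall f, minors f -> multihomogeneous f &
      forall x : 'I_n -> proj_space k r,
        X_locus d m x <-> zero_locus minors x].
Proof.
move=> minors.
have minorsH f : minors f -> multihomogeneous f.
  exact: minor_multihomogeneous.
suff locus x : X_locus d m x <-> zero_locus minors x.
  by split=> //; exists minors.
have rankP A : config_coords A x ->
    X_locus d m x <-> forall f, minors f -> eval_config A f = 0%R.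
  move=> Ax; apply: iff_trans (X_locus_rank Ax (ltnW m_lt_b)) _.
  rewrite -ltnS -[(b r d - m).+1]addn1; apply: iff_trans (rank_lt_minors _ _) _.
  split=> minor0 f min_f; first exact/minor0/eval_minor.
  by have [g min_g ->] := minor_eval min_f; apply: minor0.
split=> [Xx f min_f A Ax|zero_x]; first exact: (rankP A Ax).1 Xx f min_f.
have [A Ax] := config_coords_exists x.
by apply/(rankP A Ax) => f min_f; apply: zero_x.
Qed.
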